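(* Let $G=(V,E,\sigma,o)$ be a proper infinite tree and let $\eta\in\Lambda$. Then $$\mathrm{Mod}_{p,\sigma}(\Gamma_\infty)\ge\begin{cases}\Big(\sum_{e\in E}\sigma(e)^{-q/p}\eta(e)^q\Big)^{-p/q}&\text{if }p\in(1,\infty),\\[4pt] \Big(\sup_{e\in E}\sigma(e)^{-1}\eta(e)\Big)^{-1}&\text{if }p=1,\\[4pt] \Big(\sum_{e\in E}\sigma(e)^{-1}\eta(e)\Big)^{-1}&\text{if }p=\infty,\end{cases}$$ where $q$ is the Hölder conjugate exponent of $p$, $\frac1p+\frac1q=1$ (and where a divergent sum makes the right-hand side $0$).
   Context: A weighted rooted tree $G=(V,E,\sigma,o)$ has root $o$ and weights $\sigma:E\to\mathbb{R}_{>0}$. The generation of an edge $e$ is the number of edges on the unique path from $o$ ending with $e$; $S_1$ is the set of edges of generation $1$; $e$ is the parent of $e'$ ($e'\in c(e)$) if they are adjacent and $e'$ has generation one more. A proper infinite tree is infinite, locally finite, and every edge has at least one child. A descending path is a path $e_1e_2\cdots$ from $o$ with $e_i$ the parent of $e_{i+1}$; $\Gamma_\infty$ is the set of infinite descending paths. For $\rho:E\to[0,\infty)$, $\ell_\rho(\gamma)=\sum_{e\in\gamma}\rho(e)$ and $\mathrm{Adm}(\Gamma_\infty)=\{\rho\ge0:\ell_\rho(\gamma)\ge1\ \forall\gamma\in\Gamma_\infty\}$. Energies: $\mathcal{E}_{p,\sigma}(\rho)=\sum_{e}\sigma(e)\rho(e)^p$ for $1\le p<\infty$ and $\mathcal{E}_{\infty,\sigma}(\rho)=\sup_e\sigma(e)\rho(e)$;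 $\mathrm{Mod}_{p,\sigma}(\Gamma_\infty)=\inf_{\rho\in\mathrm{Adm}(\Gamma_\infty)}\mathcal{E}_{p,\sigma}(\rho)$. $\Lambda=\{\eta\in\mathbb{R}^E_{\ge0}:\sum_{e\in S_1}\eta(e)=1,\ \sum_{e'\in c(e)}\eta(e')=\eta(e)\ \forall e\in E\}$. *)

(* Defs.v *)
From HB Require Import structures.
From mathcomp Require Export all_boot all_order all_algebra finmap.
From mathcomp Require Export all_classical all_reals all_analysis.

Set Implicit Arguments.
Unset Strict Implicit.
Unset Printing Implicit Defensive.

Import Order.TTheory GRing.Theory Num.Theory.

Local Open Scope classical_set_scope.
Local Open Scope fset_scope.
Local Open Scope ring_scope.

(** Edges are two-element sets of vertices.  A path starting at [x] is encoded
    by the sequence [p] of its vertices other than [x]. *)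

Definition simple_graph (V : choiceType) (E : set {fset V}) : Prop :=
  forall e, E e -> #|` e| = 2%N.

Definition adj (V : choiceType) (E : set {fset V}) : rel V :=
  fun x y => [fset x; y] \in E.

Definition is_path (V : choiceType) (E : set {fset V}) (x : V) (p : seq V) :
    bool :=
  path (adj E) x p && uniq (x :: p).

Definition path_edges (V : choiceType) (x : V) (p : seq V) : seq {fset V} :=
  pairmap (fun u v => [fset u; v]) x p.

Definition is_tree (V : choiceType) (E : set {fset V}) : Prop :=
  simple_graph E /\
  forall x y : V, exists! p : seq V, is_path E x p /\ last x p = y.

Definition ends_with (V : choiceType) (x : V) (p : seq V) (e : {fset V}) :
    Prop :=
  exists s, path_edges x p = rcons s e.

Lemma ends_withE (V : choiceType) (x : V) (p : seq V) (e : {fset V}) :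
  ends_with x p e <->
  exists q u, p = rcons q u /\ e = [fset last x q; u].
Proof.
have rc q u : path_edges x (rcons q u) =
    rcons (path_edges x q) [fset last x q; u].
  by rewrite /path_edges -cats1 pairmap_cat /= cats1.
split.
  move=> [s]; case/lastP: p => [|q u]; first by case: s.
  by rewrite rc => /rcons_inj[_ <-]; exists q, u.
by move=> [q [u [-> ->]]]; exists (path_edges x q).
Qed.

Lemma is_path_rcons (V : choiceType) (E : set {fset V}) (x u : V)
    (q : seq V) :
  is_path E x (rcons q u) =
  [&& is_path E x q, adj E (last x q) u & u \notin x :: q].
Proof.
rewrite /is_path rcons_path -rcons_cons rcons_uniq.
by case: path; case: adj; case: (u \notin _); case: uniq.
Qed.

Lemma tree_path_inj (V : choiceType) (E : set {fset V}) (o : V)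
    (r r' : seq V) :
  is_tree E -> is_path E o r -> is_path E o r' -> last o r = last o r' ->
  r = r'.
Proof.
move=> [_ tE] rP rP' rr'; have [s [_ us]] := tE o (last o r').
by rewrite -(us r) // -(us r').
Qed.

Lemma ends_with_unique (V : choiceType) (E : set {fset V}) (o : V)
    (e : {fset V}) (p p' : seq V) :
  is_tree E -> is_path E o p -> is_path E o p' ->
  ends_with o p e -> ends_with o p' e -> p = p'.
Proof.
move=> treeE pP pP' /ends_withE[q [u [pE eE]]] /ends_withE[q' [u' [pE' eE']]].
have inj r r' := @tree_path_inj _ _ o r r' treeE.
subst p p'; move: (pP) (pP'); rewrite !is_path_rcons.
move=> /and3P[qP _ uq] /and3P[qP' _ uq'].
have /orP[/eqP uu'|/eqP uq''] : (u == u') || (u == last o q').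
- have : u \in e by rewrite eE !inE eqxx orbT.
  by rewrite eE' !inE orbC.
- by apply: inj => //; rewrite !last_rcons.
have /orP[/eqP uu'|/eqP u'q] : (u' == u) || (u' == last o q).
- have : u' \in e by rewrite eE' !inE eqxx orbT.
  by rewrite eE !inE orbC.
- by apply: inj => //; rewrite !last_rcons.
have := inj _ _ qP pP'; rewrite last_rcons => /(_ (esym u'q)) qE.
by move: uq; rewrite qE uq'' -rcons_cons mem_rcons inE mem_last orbT.
Qed.

Lemma ends_with_exists (V : choiceType) (E : set {fset V}) (o : V) (e : E) :
  is_tree E -> exists p, is_path E o p /\ ends_with o p (val e).
Proof.
move=> treeE; have [sE tE] := treeE; have eE : E (val e) by have := valP e; rewrite inE.
have [a [b [ab eab]]] : exists a b, a != b /\ val e = [fset a; b].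
  have e2 := sE _ eE; have /fset0Pn[a ae] : val e != fset0.
    by rewrite -cardfs_gt0 e2.
  have /eqP/cardfs1P[b eb] : #|` val e `\ a| = 1%N.
    by have := cardfsD1 a (val e); rewrite ae e2 => -[].
  exists a, b; split; last by rewrite -eb fsetD1K.
  by have : b \in val e `\ a; [rewrite eb inE|rewrite !inE eq_sym => /andP[]].
have adjab : adj E a b by rewrite /adj inE -eab.
have adjba : adj E b a by rewrite /adj fsetUC inE -eab.
have [p [[pP pa] _]] := tE o a.
have [bp|bp] := boolP (b \in o :: p); last first.
  exists (rcons p b); rewrite is_path_rcons pP pa adjab bp; split=> //.
  by apply/ends_withE; exists p, b; rewrite pa.
have [q [[qP qb] qu]] := tE o b.
have [aq|aq] := boolP (a \in o :: q); last first.
  exists (rcons q a); rewrite is_path_rcons qP qb adjba aq; split=> //.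
  by apply/ends_withE; exists q, a; rewrite qb fsetUC.
exfalso; move/negP: ab; apply; apply/eqP.
have inj r r' := @tree_path_inj _ _ o r r' treeE.
have pre r r' : is_path E o (r ++ r') -> is_path E o r.
  by rewrite /is_path cat_path -cat_cons cat_uniq => /andP[/andP[-> _] /andP[->]].
case/splitPl: bp pP pa => p1 p2 p1b pP pa.
case/splitPl: aq qP qb {qu} => q1 q2 q1a qP qb.
have p1q : p1 = q1 ++ q2 by apply: inj; rewrite ?qb ?p1b //; apply: pre pP.
have q1p : q1 = p1 ++ p2 by apply: inj; rewrite ?pa ?q1a //; apply: pre qP.
have /eqP : size q1 = (size q1 + size q2 + size p2)%N.
  by rewrite {1}q1p p1q !size_cat.
rewrite -addnA -{1}[size q1]addn0 eqn_add2l eq_sym addn_eq0 => /andP[_ /nilP p20].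
by rewrite -pa -p1b p20 cats0.
Qed.

(** In a tree, exactly one path from [o] ends with [e] ([ends_with_exists],
    [ends_with_unique]), so the default value [0] is never used. *)
Definition generation (V : choiceType) (E : set {fset V}) (o : V) (e : E) :
    nat :=
  xget 0%N [set n | exists p, [/\ is_path E o p, ends_with o p (val e)
                                & size (path_edges o p) = n]].

Lemma generationP (V : choiceType) (E : set {fset V}) (o : V) (e : E)
    (p : seq V) :
  is_tree E -> is_path E o p -> ends_with o p (val e) ->
  generation o e = size p.
Proof.
move=> tE pP pe; rewrite /generation; case: xgetP => [n _ [p' [p'P p'e <-]]|].
  by rewrite /path_edges size_pairmap (ends_with_unique tE p'P pP p'e pe).
by move=> /(_ (size p)) []; exists p; rewrite /path_edges size_pairmap.
Qed.

Definition S1 (V : choiceType) (E : set {fset V}) (o : V) : set E :=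
  [set e | generation o e = 1%N].

Definition adjacent_edges (V : choiceType) (E : set {fset V}) (e e' : E) :
    Prop :=
  e <> e' /\ exists x : V, x \in val e /\ x \in val e'.

Definition children (V : choiceType) (E : set {fset V}) (o : V) (e : E) :
    set E :=
  [set e' | adjacent_edges e e' /\ generation o e' = (generation o e).+1].

Definition locally_finite (V : choiceType) (E : set {fset V}) : Prop :=
  forall x : V, finite_set [set e : {fset V} | E e /\ x \in e].

Definition proper_infinite_tree (V : choiceType) (E : set {fset V}) (o : V) :
    Prop :=
  [/\ is_tree E, infinite_set [set: V], locally_finite E
    & forall e : E, children o e !=set0].

(** Infinite descending paths from [o]; the edge [e_(i+1)] is [gamma i]. *)
Definition Gamma_infty (V : choiceType) (E : set {fset V}) (o : V) :
    set (nat -> E) :=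
  [set gamma | (exists v : nat -> V,
                  [/\ v 0%N = o, injective v
                    & forall i, val (gamma i) = [fset v i; v i.+1]])
            /\ forall i, children o (gamma i) (gamma i.+1)].

Section modulus.
Context {R : realType} {V : choiceType} {E : set {fset V}}.
Local Open Scope ereal_scope.

(** The edges of a path are pairwise distinct, so the sum over its edges is the
    sum over its indices. *)
Definition rho_length (rho : E -> R) (gamma : nat -> E) : \bar R :=
  \sum_(0 <= i <oo) (rho (gamma i))%:E.

Definition Adm (Gamma : set (nat -> E)) : set (E -> R) :=
  [set rho | (forall e, 0 <= rho e)%R /\
             forall gamma, Gamma gamma -> 1 <= rho_length rho gamma].

(** Only used for [1 <= p]; the value at [-oo] is irrelevant. *)
Definition energy (p : \bar R) (sigma : E -> R) (rho : E -> R) : \bar R :=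
  match p with
  | r%:E => \esum_(e in [set: E]) (sigma e * rho e `^ r)%:E
  | +oo => ereal_sup [set (sigma e * rho e)%:E | e in [set: E]]
  | -oo => 0
  end.

Definition Mod (p : \bar R) (sigma : E -> R) (Gamma : set (nat -> E)) :
    \bar R :=
  ereal_inf [set energy p sigma rho | rho in Adm Gamma].

(** In a locally finite tree the index sets below are finite. *)
Definition Lambda (o : V) : set (E -> R) :=
  [set eta | [/\ forall e, (0 <= eta e)%R,
                 (\sum_(e \in S1 o) eta e)%R = 1%R
               & forall e, (\sum_(e' \in children o e) eta e')%R = eta e]].

End modulus.

(* Main.v *)
From mathcomp Require Import zify ring lra.
Require Import Defs.

(** Every admissible [rho] satisfies [\sum_e eta e * rho e >= 1].  Otherwise let
    [F < 1] be this sum and descend greedily from the root.  Since the values of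
    [eta] on the children of [e] add up to [eta e], averaging yields at each step
    a child [c] with [eta c > 0] whose subtree contributes to the sum at most
    [eta c] times [F] minus the [rho]-length already spent.  The resulting
    infinite descending path has [rho]-length at most [F], contradicting
    admissibility.  The three bounds then follow from Hoelder's inequality. *)

Import Order.TTheory GRing.Theory Num.Theory.

Local Open Scope classical_set_scope.
Local Open Scope ring_scope.
Local Open Scope ereal_scope.

(** * Sums of nonnegative extended reals, and averaging *)

Section esum_complements.
Set Implicit Arguments.
Unset Strict Implicit.
Context {R : realType} {T : choiceType}.
Implicit Types (A B : set T) (a : T -> \bar R).

Lemma esum_subset A B a : (forall x, 0 <= a x) -> A `<=` B ->
  \esum_(x in A) a x <= \esum_(x in B) a x.
Proof.
move=> a0 AB; rewrite (esumID A B)// (setIidr AB) leeDl//.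
by apply: esum_ge0.
Qed.

(** Splitting off one [D c] leaves the other sets inside its complement. Disjointness is phrased in
    the form that [disjoint_subtree] supplies. *)
Lemma sum_esum_le (s : seq T) (D : T -> set T) B a :
  (forall x, 0 <= a x) -> uniq s -> (forall c, c \in s -> D c `<=` B) ->
  (forall c d, c \in s -> d \in s -> D c `&` D d !=set0 -> c = d) ->
  \sum_(c <- s) \esum_(x in D c) a x <= \esum_(x in B) a x.
Proof.
move=> a0; elim: s B => [|c s IH] B /=; first by rewrite big_nil esum_ge0.
move=> /andP[cs us] DB Dinj; rewrite big_cons (esumID (D c) B)//.
rewrite (setIidr (DB c _)) ?mem_head// leeD2l//; apply: IH => //.
- move=> d ds x Dx; split; first by apply: DB Dx; rewrite inE ds orbT.
  move=> cx; move/negP: cs; apply; rewrite (Dinj c d) ?inE ?eqxx ?ds ?orbT//.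
  by exists x.
- by move=> d d' ds ds'; apply: Dinj; rewrite inE ?ds ?ds' orbT.
Qed.

Lemma esumZl A a (r : R) : (0 <= r)%R -> (forall x, 0 <= a x) ->
  \esum_(x in A) (r%:E * a x) = r%:E * \esum_(x in A) a x.
Proof.
move=> r0 a0; rewrite /esum -ereal_supZl//; last first.
  by apply/set0P; exists 0; exists set0; [exact: fsets_set0|rewrite fsbig_set0].
congr ereal_sup; apply/seteqP.
split => [_ [X AX <-]|_ [_ [X AX <-] <-]] /=; last first.
  by exists X => //; rewrite ge0_mule_fsumr.
exists (\sum_(x \in X) a x); first by exists X.
by rewrite ge0_mule_fsumr.
Qed.

Lemma lte_sum_seq (s : seq T) (u : T -> R) a : s != [::] ->
  (forall x, x \in s -> (u x)%:E < a x) ->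
  (\sum_(x <- s) u x)%:E < \sum_(x <- s) a x.
Proof.
elim: s => // x s IH _ ua; rewrite !big_cons.
have xa : (u x)%:E < a x by apply: ua; rewrite mem_head.
have [->|s0] := eqVneq s [::]; first by rewrite !big_nil addr0 adde0.
by rewrite EFinD lteD// IH// => y ys; rewrite ua// inE ys orbT.
Qed.

(** Averaging: otherwise [w x * t < a x] on the whole support of [w] in [A], and summing contradicts
    the bound. *)
Lemma exists_le_fsum A (w : T -> R) a (t : R) :
  (forall x, (0 <= w x)%R) -> (0 < \sum_(x \in A) w x)%R ->
  (forall s : seq T, uniq s -> (forall x, x \in s -> A x) ->
    \sum_(x <- s) a x <= ((\sum_(x \in A) w x) * t)%:E) ->
  exists x, [/\ A x, (0 < w x)%R & a x <= (w x * t)%:E].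
Proof.
(* A sum with infinite support is [0] by convention, which the positive total excludes. *)
move=> w0; case: finite_supportP => [|X XA _ XE w1 aX].
  by rewrite big_nil ltxx.
apply: contrapT => /forallNP noX.
have := aX X (fset_uniq X) (fun x xX => XA x xX).
rewrite mulr_suml leNgt => /negP; apply; apply: lte_sum_seq => [|x xX].
  by apply: contraTneq w1 => /= ->; rewrite big_nil ltxx.
rewrite ltNge; apply/negP => axt; apply: (noX x); split => //; first exact: XA.
have [_ wx] : (A `&` w @^-1` [set~ 0%R]) x by rewrite -XE.
by rewrite lt_neqAle w0 andbT eq_sym; apply/eqP; exact: wx.
Qed.

End esum_complements.

(** * Root paths, descending paths and subtrees *)

Section tree_paths.
Set Implicit Arguments.
Unset Strict Implicit.
Context {V : choiceType} {E : set {fset V}} (o : V).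
Implicit Types e c : E.

Definition root_path e : seq V :=
  xget [::] [set p | is_path E o p /\ ends_with o p (val e)].

Hypothesis treeE : is_tree E.

Lemma root_pathP e :
  is_path E o (root_path e) /\ ends_with o (root_path e) (val e).
Proof. exact: (xgetPex _ (ends_with_exists o e treeE)). Qed.

Lemma generation_root_path e : generation o e = size (root_path e).
Proof. by have [pP pe] := root_pathP e; exact: generationP. Qed.

Lemma root_path_rcons e : exists q u, root_path e = rcons q u.
Proof.
by have [_ /ends_withE[q [u [pE _]]]] := root_pathP e; exists q, u.
Qed.

Lemma val_root_path e (q : seq V) (u : V) :
  root_path e = rcons q u -> val e = [fset last o q; u]%fset.
Proof.
have [_ /ends_withE[q' [u' [-> ->]]]] := root_pathP e.
by move=> /rcons_inj[-> ->].
Qed.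

Lemma root_path_inj : injective root_path.
Proof.
move=> e c; have [q [u eq]] := root_path_rcons e.
by rewrite eq => /esym /val_root_path; rewrite -(val_root_path eq) => /val_inj.
Qed.

(** A vertex determines its path from [o], hence its distance to [o]. As the generations differ by
    one, the shared vertex must be the far end of [e] and the near end of [c]. *)
Lemma root_path_child e c :
  children o e c -> exists u, root_path c = rcons (root_path e) u.
Proof.
move=> [[_ [x [xe xc]]]]; rewrite !generation_root_path.
have [eP _] := root_pathP e; have [cP _] := root_pathP c.
have [q [u eq]] := root_path_rcons e; have [r [w cr]] := root_path_rcons c.
move: xe xc eP cP.
rewrite (val_root_path eq) (val_root_path cr) eq cr !size_rcons => xe xc eP cP.
move=> /succn_inj rq; exists w; congr (rcons _ w).
move: (eP) (cP); rewrite !is_path_rcons => /and3P[qP _ _] /and3P[rP _ _].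
have inj s t : is_path E o s -> is_path E o t -> last o s = last o t ->
    size s = size t.
  by move=> sP tP /(tree_path_inj treeE sP tP) ->.
move: xe xc; rewrite !inE => /orP[]/eqP-> /orP[]/eqP xr.
- by have := inj _ _ qP rP xr; lia.
- by have := inj _ _ qP cP; rewrite last_rcons size_rcons => /(_ xr); lia.
- by apply: (tree_path_inj treeE rP eP); rewrite last_rcons.
- by have := inj _ _ eP cP; rewrite !last_rcons !size_rcons => /(_ xr); lia.
Qed.

Lemma descending_Gamma_infty (gamma : nat -> E) :
  S1 o (gamma 0%N) -> (forall i, children o (gamma i) (gamma i.+1)) ->
  Gamma_infty o gamma.
Proof.
move=> g1 gS; split => //.
(* [Q i] leads from [o] to the [i]-th vertex, hence the shift by one; its length [i] makes the
   vertices distinct. *)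
pose Q i := if i is k.+1 then root_path (gamma k) else [::].
have QS i : exists u, Q i.+1 = rcons (Q i) u.
  case: i => [|i] /=; last exact: root_path_child.
  move: g1; rewrite /S1 /= generation_root_path.
  by case: root_path => [//|u [|//]] _; exists u.
have Qsize i : size (Q i) = i.
  by elim: i => // i IH; have [u ->] := QS i; rewrite size_rcons IH.
have Qpath i : is_path E o (Q i).
  by case: i => //= i; have [] := root_pathP (gamma i).
exists (fun i => last o (Q i)); split => //.
  move=> i j /(tree_path_inj treeE (Qpath i) (Qpath j)) ij.
  by rewrite -[i]Qsize ij.
move=> i; have [u Qu] := QS i.
by rewrite (val_root_path Qu) Qu last_rcons.
Qed.

(** The edge [e] is included; the prefix order reduces nesting and disjointness to comparisons of
    sequences. *)
Definition subtree e : set E :=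
  [set c | prefix (root_path e) (root_path c)].

Lemma subtree_child e c : children o e c -> subtree c `<=` subtree e `\ e.
Proof.
move=> /root_path_child[u cu] x; rewrite /subtree /= cu => xc; split.
  by apply: prefix_trans xc; exact: prefix_rcons.
move=> xe; have := size_prefix xc; rewrite xe size_rcons; lia.
Qed.

(** Two prefixes of equal length of one sequence coincide. *)
Lemma disjoint_subtree e c :
  generation o e = generation o c -> subtree e `&` subtree c !=set0 -> e = c.
Proof.
rewrite !generation_root_path => sec [x []]; rewrite /subtree /=.
rewrite !prefixE sec => /eqP xe /eqP xc.
by apply: root_path_inj; exact: etrans (esym xe) xc.
Qed.

End tree_paths.

(** * Pairing admissible densities with unit flows, and Young's inequality *)

Section modulus_lower_bounds.
Set Implicit Arguments.
Unset Strict Implicit.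
Context {R : realType} {V : choiceType} {E : set {fset V}} (o : V).
Implicit Types (eta rho sigma : E -> R).

Lemma admissible_esum_ge1 eta rho : is_tree E -> Lambda o eta ->
  Adm (Gamma_infty o) rho -> 1 <= \esum_(e in [set: E]) (eta e * rho e)%:E.
Proof.
move=> treeE [eta0 etaS1 etaC] [rho0 rhoL]; rewrite leNgt; apply/negP => F1.
pose w e := (eta e * rho e)%:E.
have w0 e : 0 <= w e by rewrite lee_fin mulr_ge0.
pose f e := \esum_(x in subtree o e) w x.
have [F FE] : exists F, \esum_(e in [set: E]) w e = F%:E.
  exists (fine (\esum_(e in [set: E]) w e)); rewrite fineK//.
  by rewrite ge0_fin_numE ?esum_ge0// (lt_trans F1) ?ltry.
(* [x.2] is [F] minus the [rho]-length of the path down to, but not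
   including, the edge [x.1]. *)
pose inv (x : E * R) := (0 < eta x.1)%R /\ f x.1 <= (eta x.1 * x.2)%:E.
have [e0 [e0S1 inv0]] : exists e, S1 o e /\ inv (e, F).
  have [|s us sS1|e [? ? ?]] := @exists_le_fsum R E (S1 o) eta f F eta0.
  - by rewrite etaS1.
  - rewrite etaS1 mul1r -FE; apply: sum_esum_le => // c d cs ds.
    by apply: (disjoint_subtree treeE); rewrite (sS1 c cs) (sS1 d ds).
  - by exists e.
(* With [inv x] as a premise under the existential, [choice] yields a total function [next]. *)
have descend x : exists c,
    inv x -> children o x.1 c /\ inv (c, (x.2 - rho x.1)%R).
  have [[etax fx]|?] := pselect (inv x); last by exists x.1.
  have [|s us sC|c [? ? ?]] :=
    @exists_le_fsum R E (children o x.1) eta f (x.2 - rho x.1)%R eta0.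
  - by rewrite etaC.
  (* Removing the term [eta x.1 * rho x.1] of the edge itself leaves at most
     [eta x.1 * (x.2 - rho x.1)] for the disjoint subtrees of its children. *)
  - rewrite etaC mulrBr EFinB leeBrDl//; apply: le_trans fx.
    rewrite /f (esumID [set x.1] (subtree o x.1))//.
    rewrite (_ : _ `&` [set x.1] = [set x.1]); last first.
      by apply/setIidr => _ ->; exact: prefix_refl.
    rewrite esum_set1// leeD2l//; apply: sum_esum_le => // [c cs|c d cs ds].
      exact: (subtree_child treeE (sC c cs)).
    apply: (disjoint_subtree treeE).
    by have [_ ->] := sC c cs; have [_ ->] := sC d ds.
  - by exists c.
have [next nextP] := choice descend.
pose state n := iter n (fun x => (next x, x.2 - rho x.1)%R) (e0, F).
have stateP n : inv (state n).
  by elim: n => // n IH; have [] := nextP _ IH.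
pose gamma n := (state n).1.
have Ggamma : Gamma_infty o gamma.
  apply: (descending_Gamma_infty treeE) => // n.
  by have [] := nextP _ (stateP n).
have spent n : (state n).2 = (F - \sum_(0 <= i < n) rho (gamma i))%R.
  elim: n => [|n IH]; first by rewrite big_geq// subr0.
  by rewrite big_nat_recr//= IH opprD addrA.
have lengthF : rho_length rho gamma <= F%:E.
  apply: lime_le; first by apply: is_cvg_nneseries => n _ _; rewrite lee_fin.
  apply: nearW => n; rewrite sumEFin lee_fin -subr_ge0 -spent.
  (* Since [f] is nonnegative and [eta] is positive at this edge, the remaining budget is
     nonnegative. *)
  have [eta_gt0 fn] := stateP n.
  rewrite -(pmulr_rge0 _ eta_gt0) -lee_fin; apply: le_trans fn.
  exact: esum_ge0.
have := le_trans (rhoL _ Ggamma) lengthF.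
by rewrite -FE leNgt F1.
Qed.

(** The inverse of [+oo] is [0], and [b = 0] violates the premise, so only positive finite [b]
    matter. *)
Lemma inve_le (b x : \bar R) : 0 <= b -> 0 <= x ->
  (forall r : R, b = r%:E -> 1 <= b * x) -> b^-1 <= x.
Proof.
case: b => [r| |]// r0 x0 /(_ _ erefl) rx; have r_gt0 : (0 < r)%R.
  rewrite lt_neqAle; apply/andP; split => //; apply: contraTneq rx => <-.
  by rewrite mul0e -ltNge lte01.
by rewrite inver gt_eqF// -[_%:E]mule1 lee_pdivrMl.
Qed.

(** Young's inequality in a form that can be summed over the edges: with [b] the
    dual energy, the last terms add up to [1 / q]. *)
Lemma conjugate_powR_weighted (p q b s x y : R) :
  (0 < p -> 0 < q -> p^-1 + q^-1 = 1 -> 0 < b -> 0 < s -> 0 <= x -> 0 <= y ->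
  y * x <= b `^ (p / q) / p * (s * x `^ p)
           + b^-1 / q * (s `^ (- (q / p)) * y `^ q))%R.
Proof.
move=> p0 q0 pq b0 s0 x0 y0.
have pN0 : (p != 0)%R by rewrite gt_eqF.
have qN0 : (q != 0)%R by rewrite gt_eqF.
(* Young's inequality is applied to [u * x] and [u^-1 * y]; the required coefficient of x^p forces
   u^p = b^(p/q) s. *)
pose u := (b `^ q^-1 * s `^ p^-1)%R.
have u0 : (0 < u)%R by rewrite mulr_gt0 ?powR_gt0.
have -> : (y * x = (u * x) * (u^-1 * y))%R by field; rewrite gt_eqF.
apply: le_trans (@conjugate_powR _ _ _ p q _ _ p0 q0 pq) _.
- by rewrite mulr_ge0 // ltW.
- by rewrite mulr_ge0 // invr_ge0 ltW.
have up : (u `^ p = b `^ (p / q) * s)%R.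
  rewrite powRM ?powR_ge0// -!powRrM mulVf// powRr1 1?ltW//.
  by rewrite [(q^-1 * p)%R]mulrC.
have uq : (u^-1 `^ q = b^-1 * s `^ (- (q / p)))%R.
  rewrite -powR_inv1 ?(ltW u0)// -powRrM mulN1r powRM ?powR_ge0// -!powRrM.
  rewrite mulrN mulVf// powR_inv1 ?(ltW b0)//.
  by rewrite mulrN [(p^-1 * q)%R]mulrC.
rewrite powRM ?(ltW u0)// up powRM ?invr_ge0 ?(ltW u0)// uq.
by rewrite le_eqVlt; apply/orP; left; apply/eqP; field; rewrite pN0 qN0 gt_eqF.
Qed.

(** * The bounds for [1 < p] finite, [p = 1] and [p = +oo] *)

Variables (sigma eta : E -> R).
Hypothesis sigma_gt0 : forall e, (0 < sigma e)%R.
Hypothesis treeE : is_tree E.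
Hypothesis eta_Lambda : Lambda o eta.

Let eta_ge0 e : (0 <= eta e)%R. Proof. by have [] := eta_Lambda. Qed.

(** Makes the dual sum positive, and provides an edge, so that the suprema below are not [-oo]. *)
Lemma Lambda_pos : exists e, (0 < eta e)%R.
Proof.
have [_ etaS1 _] := eta_Lambda.
have [||e [_ e0 _]] := @exists_le_fsum R E (S1 o) eta (cst 0) 0%R eta_ge0.
- by rewrite etaS1.
- by move=> s _ _; rewrite mulr0 big1.
- by exists e.
Qed.

(** With [A] the energy and [b] the dual sum, summing Young's inequality gives 1 <= (b^(p/q) / p) A
    + 1/q; since 1 - 1/q = 1/p, the factor 1/p cancels. *)
Lemma Mod_ge (p q : R) : (1 < p)%R -> (p^-1 + q^-1 = 1)%R ->
  ((\esum_(e in [set: E]) (sigma e `^ (- (q / p)) * eta e `^ q)%:E)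
     `^ (p / q))^-1
  <= Mod p%:E sigma (Gamma_infty o).
Proof.
move=> p1 pq; have p0 : (0 < p)%R by lra.
have q0 : (0 < q)%R.
  have -> : q = (1 - p^-1)^-1%R by rewrite -pq addrC addKr invrK.
  by rewrite invr_gt0 subr_gt0 invf_lt1.
apply/ereal_infP => _ [rho rhoAdm <-]; have [rho0 _] := rhoAdm.
set B := \esum_(e in _) _; set A := energy _ _ _.
have A0 : 0 <= A.
  by apply: esum_ge0 => e _; rewrite lee_fin mulr_ge0 ?powR_ge0 ?ltW.
apply: inve_le => //; first exact: poweR_ge0.
have tau0 e : 0 <= (sigma e `^ (- (q / p)) * eta e `^ q)%:E.
  by rewrite lee_fin mulr_ge0 ?powR_ge0.
have [e e0] := Lambda_pos.
have : 0 < B.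
  apply: (@lt_le_trans _ _ (sigma e `^ (- (q / p)) * eta e `^ q)%:E).
    by rewrite lte_fin mulr_gt0 ?powR_gt0.
  rewrite -(@esum_set1 _ _ e
    (fun x => (sigma x `^ (- (q / p)) * eta x `^ q)%:E))//.
  exact: esum_subset.
(* A divergent dual sum has power [+oo], which is not the finite value [r] assumed. *)
case BE : B => [b| |]//; last first.
  by move=> _ r; rewrite poweRyr ?mulf_neq0 ?invr_eq0 ?gt_eqF.
rewrite lte_fin => b0 r _; rewrite poweR_EFin.
have sumE : \esum_(e in [set: E])
    ((b `^ (p / q) / p)%:E * (sigma e * rho e `^ p)%:E
     + (b^-1 / q)%:E * (sigma e `^ (- (q / p)) * eta e `^ q)%:E)
    = (b `^ (p / q) / p)%:E * A + (q^-1)%:E.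
  rewrite esumD; last 2 first.
  - by move=> *; rewrite -EFinM lee_fin !mulr_ge0 ?invr_ge0 ?powR_ge0 ?ltW.
  - by move=> *; rewrite -EFinM lee_fin !mulr_ge0 ?invr_ge0 ?powR_ge0 ?ltW.
  rewrite !esumZl// ?mulr_ge0 ?invr_ge0 ?powR_ge0 ?ltW//; last first.
    by move=> *; rewrite lee_fin mulr_ge0 ?powR_ge0 ?ltW.
  rewrite -/B BE; congr (_ + _); rewrite -EFinM; congr EFin.
  by field; rewrite !gt_eqF.
have : 1 <= (b `^ (p / q) / p)%:E * A + (q^-1)%:E.
  rewrite -sumE.
  apply: le_trans (admissible_esum_ge1 treeE eta_Lambda rhoAdm) _.
  apply: le_esum => x _; rewrite -!EFinM -EFinD lee_fin.
  exact: conjugate_powR_weighted.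
rewrite -leeBlDr// -EFinB.
have -> : (1 - q^-1 = p^-1 * 1)%R by lra.
rewrite [(b `^ _ / p)%R]mulrC !EFinM -muleA.
by rewrite lee_pmul2l// lte_fin invr_gt0.
Qed.

(** If the supremum is a finite [b], then [eta e <= b * sigma e] for every edge. *)
Lemma Mod1_ge :
  (ereal_sup [set ((sigma e)^-1 * eta e)%:E | e in [set: E]])^-1
  <= Mod 1 sigma (Gamma_infty o).
Proof.
apply/ereal_infP => _ [rho rhoAdm <-]; have [rho0 _] := rhoAdm.
set B := ereal_sup _.
have B_ub e : ((sigma e)^-1 * eta e)%:E <= B.
  by apply: ereal_sup_ubound; exists e.
have srho0 e : (0 <= sigma e * rho e `^ 1)%R.
  by rewrite mulr_ge0 ?powR_ge0 ?ltW.
have [e0 _] := Lambda_pos.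
have B0 : 0 <= B.
  by apply: le_trans (B_ub e0); rewrite lee_fin mulr_ge0// invr_ge0 ltW.
apply: inve_le => //; first by apply: esum_ge0 => e _; rewrite lee_fin.
move=> b BE; move: B_ub B0; rewrite BE lee_fin => B_ub b0.
rewrite /= -esumZl//.
apply: le_trans (admissible_esum_ge1 treeE eta_Lambda rhoAdm) _.
apply: le_esum => e _; rewrite -EFinM lee_fin powRr1// mulrA.
by rewrite ler_wpM2r// -ler_pdivrMr// mulrC -lee_fin.
Qed.

(** If the energy is a finite [a], then [rho e <= a / sigma e] for every edge. *)
Lemma Mody_ge :
  (\esum_(e in [set: E]) ((sigma e)^-1 * eta e)%:E)^-1
  <= Mod +oo sigma (Gamma_infty o).
Proof.
apply/ereal_infP => _ [rho rhoAdm <-]; have [rho0 _] := rhoAdm.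
have tau0 e : 0 <= ((sigma e)^-1 * eta e)%:E.
  by rewrite lee_fin mulr_ge0// invr_ge0 ltW.
set A := energy _ _ _; have A_ub e : (sigma e * rho e)%:E <= A.
  by apply: ereal_sup_ubound; exists e.
have [e0 _] := Lambda_pos.
have A0 : 0 <= A.
  by apply: le_trans (A_ub e0); rewrite lee_fin mulr_ge0// ltW.
(* Moving the inverse onto [A] lets [inve_le] dispose of the energies [0] and [+oo]. *)
rewrite inve_ple ?inE ?esum_ge0//.
apply: inve_le => //; first exact: esum_ge0.
move=> a AE; move: A_ub A0; rewrite AE lee_fin => A_ub a0.
rewrite -esumZl//.
apply: le_trans (admissible_esum_ge1 treeE eta_Lambda rhoAdm) _.
apply: le_esum => e _; rewrite -EFinM lee_fin mulrA [leLHS]mulrC.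
by rewrite ler_wpM2r// ler_pdivlMr// mulrC -lee_fin.
Qed.

End modulus_lower_bounds.

Theorem theorem6 (R : realType) (V : choiceType) (E : set {fset V})
    (sigma : E -> R) (o : V) (eta : E -> R)
    (sigma_gt0 : forall e : E, (0 < sigma e)%R)
    (Gproper : proper_infinite_tree E o)
    (eta_Lambda : Lambda o eta) :
  [/\ (forall p q : R, (1 < p)%R -> (p^-1 + q^-1 = 1)%R ->
        ((\esum_(e in [set: E]) (sigma e `^ (- (q / p)) * eta e `^ q)%:E)
           `^ (p / q))^-1
        <= Mod p%:E sigma (Gamma_infty o)),
      (ereal_sup [set ((sigma e)^-1 * eta e)%:E | e in [set: E]])^-1
        <= Mod 1 sigma (Gamma_infty o)
    & (\esum_(e in [set: E]) ((sigma e)^-1 * eta e)%:E)^-1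
        <= Mod +oo sigma (Gamma_infty o)].
Proof.
have [treeE _ _ _] := Gproper.
split; [move=> p q; exact: Mod_ge|exact: Mod1_ge|exact: Mody_ge].
Qed.
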